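(* Let $n\ge 5$ and $k\ge 4$ be integers, and let $B(n,k)$ be the $(n,k)$-banana tree. Then its line graph $\mathcal{L}(B(n,k))$ is a lower bound block graph and $$rn(\mathcal{L}(B(n,k)))=n(k+6)-5.$$
   Context: Graphs are finite and simple. For a connected graph $G$, $d(u,v)$ is the distance and $d(G)$ the diameter. A radio labeling of $G$ is a map $f:V(G)\to\{0,1,2,\ldots\}$ with $|f(u)-f(v)|\ge d(G)+1-d(u,v)$ for all distinct $u,v$. Its span is $\max\{|f(u)-f(v)|:u,v\in V(G)\}$, and $rn(G)$ is the minimum span of a radio labeling of $G$. A block is a maximal connected induced subgraph without cut-vertices (of itself). A block graph is a connected graph all of whose blocks are complete graphs; line graphs of trees are block graphs. The weight at $v$ is $wt(v)=\sum_{u\in V(G)}d(u,v)$, and $W(G)$ is the set of vertices of minimum weight (weight centers). If $|W(G)|\ge2$, then $W(G)$ is contained in a (unique) block, called the central block. The central vertices of $G$ are: the unique weight center if $|W(G)|=1$; all vertices of the central block if $|W(G)|\ge 2$. The level of $v$ is $L(v)=\min\{d(v,w): w \text{ a central vertex}\}$ and $L(G)=\sum_{v\in V(G)}L(v)$. Set $\varepsilon(G)=1$ if $|W(G)|=1$ and $\varepsilon(G)=0$ if $|W(G)|\ge2$. For a block graph $G$ of order $p$ put $LB(G)=(p-1)(d(G)+\varepsilon(G))-2L(G)+\varepsilon(G)$; $G$ is called a lower bound block graph if $rn(G)=LB(G)$. The line graph $\mathcal{L}(T)$ has the edges of $T$ as vertices, two being adjacent if they share an endpoint. The $(n,k)$-banana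 tree $B(n,k)$ is the rooted tree of height 3 in which the root has degree $n$, every vertex at distance 1 from the root has degree $2$, every vertex at distance 2 from the root has degree $k-1$, and the vertices at distance 3 are leaves. *)

(* Defs.v *)
From HB Require Import structures.
From mathcomp Require Import all_boot all_order all_algebra.
From mathcomp Require Import boolp zify.

Set Implicit Arguments.
Unset Strict Implicit.
Unset Printing Implicit Defensive.

Import Order.TTheory GRing.Theory.

Record sgraph := SGraph {
  vertex :> finType;
  adj : rel vertex;
  adj_sym : symmetric adj;
  adj_irrefl : irreflexive adj }.

Section Distance.
Variable G : sgraph.

(* A shortest walk has length < #|G|, so the default value #|G| is returned
   exactly when no walk joins u to v. *)
Definition dist (u v : G) : nat :=
  \big[minn/#|G|]_(l < #|G| |
     [exists p : l.-tuple G, path (@adj G) u p && (last u p == v)]) l.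

Lemma dist_le u v p :
  path (@adj G) u p -> last u p = v -> (dist u v <= size p)%N.
Proof.
move=> up lp; rewrite /dist -minEnat -leEnat.
case: (ltnP (size p) #|G|) => [lt_p|]; last first.
  by move=> le_p; apply: le_trans (bigmin_le_id _ _ _ _) _.
apply: (bigmin_inf (Ordinal lt_p)) => //=.
by apply/existsP; exists (in_tuple p); rewrite /= up lp eqxx.
Qed.

Lemma dist_ge u v m : (m <= #|G|)%N ->
  (forall p, path (@adj G) u p -> last u p = v -> (m <= size p)%N) ->
  (m <= dist u v)%N.
Proof.
move=> le_m min_m; rewrite /dist -minEnat -leEnat.
apply: le_bigmin => // l /existsP[p /andP[up /eqP lp]].
by rewrite leEnat -(size_tuple p) min_m.
Qed.

Definition diam : nat := \max_(u : G) \max_(v : G) dist u v.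

Definition degree (v : G) : nat := #|[set u | adj v u]|.

Definition acyclic : Prop :=
  forall c : seq G, (2 < size c)%N -> ~ ucycle (@adj G) c.

Definition rooted_height (r : G) : nat := \max_(v : G) dist r v.

End Distance.

Section RadioNumber.
Variable G : sgraph.

Definition radio_labeling (f : G -> nat) : Prop :=
  forall u v : G, u != v -> (diam G + 1 - dist u v <= `|f u - f v|)%N.

Definition label_span (f : G -> nat) : nat :=
  \max_(u : G) \max_(v : G) `|f u - f v|%N.

Definition is_radio_span (m : nat) : Prop :=
  exists2 f : G -> nat, radio_labeling f & label_span f = m.

Lemma radio_span_exists : exists m, `[< is_radio_span m >].
Proof.
pose f (u : G) := (enum_rank u * (diam G).+1)%N.
exists (label_span f); apply/asboolP; exists f => // u v neq_uv.
rewrite addn1; apply: leq_trans (leq_subr _ _) _.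
have neq_r : (enum_rank u : nat) != enum_rank v.
  by apply: contra neq_uv => /eqP /ord_inj /enum_rank_inj ->.
wlog lt_uv : u v neq_uv neq_r / (enum_rank u < enum_rank v)%N.
  move=> H; case: (ltngtP (enum_rank u) (enum_rank v)) => [lt|gt|eq].
  - exact: H.
  - by rewrite distnC; apply: H => //; rewrite eq_sym.
  - by rewrite eq eqxx in neq_r.
rewrite distnC distnEl /f ?leq_mul2r ?(ltnW lt_uv) ?orbT // -mulnBl.
by rewrite leq_pmull // subn_gt0.
Qed.

Definition radio_number : nat := ex_minn radio_span_exists.

End RadioNumber.

Section Blocks.
Variable G : sgraph.
Implicit Types B : {set G}.

Definition induced_adj B : rel G :=
  [rel u v | [&& u \in B, v \in B & adj u v]].

Definition induced_connected B : bool :=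
  [forall u in B, forall v in B, connect (induced_adj B) u v].

Definition connected_graph : bool :=
  (0 < #|G|)%N && induced_connected [set: G].

(* Only meant for B inducing a connected subgraph: v is then a cut-vertex
   when its removal disconnects that subgraph. *)
Definition cut_vertex B (v : G) : bool :=
  (v \in B) && ~~ induced_connected (B :\ v).

Definition nonseparable B : bool :=
  [&& B != set0, induced_connected B & [forall v, ~~ cut_vertex B v]].

Definition block B : bool := maxset nonseparable B.

Definition complete_set B : bool :=
  [forall u in B, forall v in B, (u != v) ==> adj u v].

Definition block_graph : bool :=
  connected_graph && [forall B : {set G}, block B ==> complete_set B].

Definition wt (v : G) : nat := \sum_(u : G) dist u v.

Definition weight_centers : {set G} :=
  [set v | [forall u, wt v <= wt u]%N].

(* At most one block contains two given distinct vertices, so the choice made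
   by [pick] is irrelevant when there are at least two weight centers. *)
Definition central_block : {set G} :=
  odflt set0 [pick B : {set G} | block B && (weight_centers \subset B)].

Definition central_vertices : {set G} :=
  if #|weight_centers| == 1%N then weight_centers else central_block.

(* Distances never exceed #|G|, so the default value of the minimum is inert
   as soon as there is a central vertex. *)
Definition level (v : G) : nat :=
  \big[minn/#|G|]_(w in central_vertices) dist v w.

Definition total_level : nat := \sum_(v : G) level v.

Definition epsilon : nat := (#|weight_centers| == 1%N).

Definition LB : int :=
  ((#|G|%:Z - 1) * ((diam G)%:Z + epsilon%:Z) - 2 * total_level%:Z
   + epsilon%:Z)%R.

Definition lower_bound_block_graph : Prop :=
  block_graph /\ (radio_number G)%:Z%R = LB.

End Blocks.

Section LineGraph.
Variable G : sgraph.

Definition edges : {set {set G}} :=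
  [set [set u.1; u.2] | u : G * G & adj u.1 u.2].

Definition line_vertex : finType := {E : {set G} | E \in edges}.

Definition line_adj : rel line_vertex :=
  [rel E F | (E != F) && (val E :&: val F != set0)].

Lemma line_adj_sym : symmetric line_adj.
Proof. by move=> E F; rewrite /line_adj /= setIC [E == F]eq_sym. Qed.

Lemma line_adj_irrefl : irreflexive line_adj.
Proof. by move=> E; rewrite /line_adj /= eqxx. Qed.

Definition line_graph : sgraph := SGraph line_adj_sym line_adj_irrefl.

End LineGraph.

Section Banana.
Variables n k : nat.

(* A vertex of degree k - 1 at distance 2 from the root has k - 2 children. *)
Inductive banana_vertex :=
  | Root
  | Mid of 'I_n
  | Hub of 'I_n
  | Leaf of 'I_n & 'I_(k - 2).

Definition banana_encode (v : banana_vertex) :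
    unit + 'I_n + 'I_n + 'I_n * 'I_(k - 2) :=
  match v with
  | Root => inl (inl (inl tt))
  | Mid i => inl (inl (inr i))
  | Hub i => inl (inr i)
  | Leaf i j => inr (i, j)
  end.

Definition banana_decode (c : unit + 'I_n + 'I_n + 'I_n * 'I_(k - 2)) :=
  match c with
  | inl (inl (inl _)) => Root
  | inl (inl (inr i)) => Mid i
  | inl (inr i) => Hub i
  | inr (i, j) => Leaf i j
  end.

Lemma banana_encodeK : cancel banana_encode banana_decode.
Proof. by case. Qed.

HB.instance Definition _ :=
  Finite.copy banana_vertex (can_type banana_encodeK).

Definition banana_parent (v : banana_vertex) : option banana_vertex :=
  match v with
  | Root => None
  | Mid _ => Some Root
  | Hub i => Some (Mid i)
  | Leaf i _ => Some (Hub i)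
  end.

Definition banana_adj : rel banana_vertex :=
  [rel u v | (banana_parent u == Some v) || (banana_parent v == Some u)].

Lemma banana_adj_sym : symmetric banana_adj.
Proof. by move=> u v; rewrite /banana_adj /= orbC. Qed.

Lemma banana_adj_irrefl : irreflexive banana_adj.
Proof. by move=> u; apply/negP => /orP[] /eqP; case: u. Qed.

Definition banana : sgraph := SGraph banana_adj_sym banana_adj_irrefl.

Definition banana_depth (v : banana) : nat :=
  match v with Root => 0 | Mid _ => 1 | Hub _ => 2 | Leaf _ _ => 3 end.

Lemma banana_adjP (u v : banana) :
  reflect (banana_parent u = Some v \/ banana_parent v = Some u) (adj u v).
Proof.
rewrite /adj /= /banana_adj /=.
apply: (iffP orP) => -[].
- by move/eqP; left.
- by move/eqP; right.
- by move=> ->; left.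
- by move=> ->; right.
Qed.

Lemma banana_parent_depth (u v : banana) :
  banana_parent u = Some v -> banana_depth u = (banana_depth v).+1.
Proof. by case: u => [|i|i|i j] //= [<-]. Qed.

Lemma banana_path_depth (u : banana) p :
  path (@adj banana) u p -> (banana_depth (last u p) <= banana_depth u + size p)%N.
Proof.
elim: p u => [|v p IH] u /=; first by rewrite addn0.
case/andP=> /banana_adjP uv /IH /leq_trans; apply.
rewrite addnS -addSn leq_add2r.
by case: uv => /banana_parent_depth -> //; rewrite ltnW // ltnW.
Qed.

Lemma banana_parent_path (v : banana) : exists p : seq banana,
  [/\ size p = banana_depth v, path (@adj banana) Root p & last (Root : banana) p = v].
Proof.
pose q : seq banana := match v with Root => [::] | Mid i => [:: Mid i]
  | Hub i => [:: Mid i; Hub i] | Leaf i j => [:: Mid i; Hub i; Leaf i j] end.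
exists q; rewrite /q {q}.
by case: v => [|i|i|i j]; split; rewrite //= /banana_adj /= !eqxx ?orbT.
Qed.

Lemma card_banana : #|banana| = (1 + n + n + n * (k - 2))%N.
Proof.
have codeK : cancel banana_decode banana_encode by case=> [[[[]|i]|i]|[i j]].
have bij : bijective banana_encode by exists banana_decode; [exact: banana_encodeK|].
by rewrite (bij_eq_card bij) !card_sum card_prod !card_ord card_unit.
Qed.

Lemma banana_dist (v : banana) : dist (Root : banana) v = banana_depth v.
Proof.
apply/eqP; rewrite eqn_leq; apply/andP; split.
  by have [p [<- rp lp]] := banana_parent_path v; apply: dist_le.
apply: dist_ge => [|p /banana_path_depth + lp]; last by rewrite lp.
rewrite card_banana; case: v => [|i|i|i j] //=; case: n i => [[]//|m] i; first by lia.
by case: (k - 2)%N j => [[]//|l] _; nia.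
Qed.

Lemma banana_connected : connected_graph banana.
Proof.
rewrite /connected_graph card_banana /=.
have cR (v : banana) : connect (induced_adj [set: banana]) Root v.
  have [p [_ rp <-]] := banana_parent_path v; apply/connectP; exists p => //.
  by rewrite (eq_path (e' := @adj banana)) // => x y; rewrite /induced_adj /= !in_setT.
have sym : connect_sym (induced_adj [set: banana]).
  by apply: sym_connect_sym => x y; rewrite /induced_adj /= !in_setT; exact: banana_adj_sym.
apply/forall_inP => u _; apply/forall_inP => v _.
by apply: connect_trans (cR v); rewrite sym.
Qed.

Lemma banana_acyclic : acyclic banana.
Proof.
move=> c size_c /andP[cyc_c uniq_c].
have [x0 x0c] : exists x, x \in c by case: c size_c {cyc_c uniq_c} => // x c _; exists x; rewrite inE eqxx.
case: (arg_maxnP (P := mem c) banana_depth x0c) => x xc max_x.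
have up y : y \in c -> adj x y -> banana_parent x = Some y.
  move=> yc /banana_adjP[//|/banana_parent_depth dy].
  by have := max_x y yc; rewrite /= dy ltnn.
have [i s def_s] := rot_to xc.
have mem_s y : y \in s -> y \in c by move=> ys; rewrite -(mem_rot i c) def_s inE ys orbT.
move: size_c uniq_c cyc_c.
rewrite -(size_rot i c) -(rot_uniq i c) -(rot_cycle i (@adj banana) c) def_s.
case: s {def_s} mem_s => [//|y s]; case/lastP: s => [//|s z] mem_s _.
rewrite /= rcons_path last_rcons => /and3P[_ y_s _] /and3P[xy _ zx].
have xz : adj x z by rewrite adj_sym; exact: zx.
have zs : z \in c by apply: mem_s; rewrite inE mem_rcons inE eqxx orbT.
have ys : y \in c by apply: mem_s; rewrite inE eqxx.
have := up z zs xz; rewrite (up y ys xy) => -[eq_yz].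
by rewrite eq_yz mem_rcons inE eqxx in y_s.
Qed.

Lemma banana_degree (v : banana) :
  degree v = match v with
             | Root => n | Mid _ => 2 | Hub _ => (k - 2).+1 | Leaf _ _ => 1
             end.
Proof.
rewrite /degree; case: v => [|i|i|i j].
- transitivity #|[set Mid i | i : 'I_n]|.
    apply: eq_card => v; rewrite inE; apply/banana_adjP/imsetP.
      by case: v => [|i|i|i j] [] //= _; exists i.
    by case=> i _ ->; right.
  by rewrite card_imset ?card_ord // => i j [].
- transitivity #|[set (Root : banana); (Hub i : banana)]|; last by rewrite cards2.
  apply: eq_card => v; rewrite !inE; apply/banana_adjP/orP.
    case: v => [|i'|i'|i' j] [] //=; first by left.
    by move=> [->]; right.
  by case=> /eqP ->; [left|right].
- transitivity #|(Mid i : banana) |: [set (Leaf i j : banana) | j : 'I_(k - 2)]|.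
    apply: eq_card => v; rewrite !inE; apply/banana_adjP/orP.
      case: v => [|i'|i'|i' j] [] //= [->]; first by left.
      by right; apply/imsetP; exists j.
    by case=> [/eqP -> | /imsetP[j _ ->]]; [left|right].
  rewrite cardsU1 card_imset ?card_ord => [|j j' [] //].
  by case: imsetP => // -[].
- rewrite -(cards1 (Hub i : banana)); apply: eq_card => v; rewrite !inE.
  apply/banana_adjP/eqP => [|->]; last by left.
  by case: v => [|i'|i'|i' j'] [] //= [->].
Qed.

(* The rooted tree just built is the banana tree: for n > 0 and k > 2 it has
   the prescribed height and degrees. *)
Lemma bananaP : (0 < n)%N -> (2 < k)%N ->
  [/\ connected_graph banana /\ acyclic banana,
      rooted_height (Root : banana) = 3,
      degree (Root : banana) = n
    & forall v : banana,
      [/\ dist (Root : banana) v = 1 -> degree v = 2,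
          dist (Root : banana) v = 2 -> degree v = k - 1
        & dist (Root : banana) v = 3 -> degree v = 1]%N].
Proof.
move=> n_gt0 k_gt2; split; first by split; [exact: banana_connected|exact: banana_acyclic].
- apply/eqP; rewrite eqn_leq; apply/andP; split.
    by apply/bigmax_leqP => v _; rewrite banana_dist; case: v.
  have lt_k : (0 < k - 2)%N by rewrite subn_gt0.
  rewrite -[X in (X <= _)%N](banana_dist (Leaf (Ordinal n_gt0) (Ordinal lt_k))).
  exact: (leq_bigmax (F := fun v => dist (Root : banana) v)).
- exact: banana_degree.
move=> v; rewrite banana_dist banana_degree.
by case: v => [|i|i|i j]; split=> //=; lia.
Qed.

End Banana.

(* Main.v *)
Require Import Defs.
From mathcomp Require Import all_boot all_order all_algebra.
From mathcomp Require Import boolp zify.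

Set Implicit Arguments.
Unset Strict Implicit.
Unset Printing Implicit Defensive.

(** Write G for the line graph of the banana tree. Its vertices fall into n
    branches; branch i holds the edge at the root (level 0), the edge below it
    (level 1) and k - 2 pendant edges (level 2). The level-0 edges form a
    clique through which every path between two branches passes, so vertices
    u, v of distinct branches are at distance L(u) + L(v) + 1, whereas inside
    a branch the distance is smaller. The diameter is therefore 5
    ([dist_edge], [diam_banana_line]).

    Lower bound: if the vertices are sorted by label, consecutive labels differ
    by at least 6 - d(u,v) >= 5 - L(u) - L(v). Summing over the ordering,
    every level is subtracted twice, except at the two ends
    ([radio_span_ge]).

    Upper bound: all these inequalities become equalities for an ordering which
    begins and ends at level 0 and changes branch at every step. The labels
    are then the partial sums of the gaps 5 - L(u) - L(v). Vertices of
    distinct branches satisfy the radio condition automatically, because 5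
    exceeds twice any level, and two vertices of the same branch satisfy it as
    soon as their labels differ by 5, which holds when they are at least 5
    places apart, all gaps being positive ([radio_number_spread]). As
    n >= 5, running cyclically through the branches k times achieves this: the
    last branch is traversed upwards and all the others downwards, so that the
    first and the last vertex are both at level 0 ([visit]).

    It remains to identify the ingredients of the lower bound. Deleting a
    level-0 or level-1 vertex cuts off the deeper part of its branch, and these
    cuts separate any two non-adjacent vertices, so blocks are complete
    ([banana_line_nonseparable_complete]). Moving from level 0 down a branch
    brings at most k vertices closer and moves the (n - 1)k others away, so
    the weight centers are the n vertices of level 0
    ([weight_centers_banana_line]); they form a block, the level of the
    definition is the level used above, and both computations of the radio
    number agree. *)

(** * Distances from a candidate formula *)

Lemma dist_gt0 (G : sgraph) (x y : G) : x != y -> 0 < dist x y.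
Proof.
move=> xy; apply: dist_ge => [|[|z p] //= _ eq_xy].
  by apply/card_gt0P; exists x.
by rewrite eq_xy eqxx in xy.
Qed.

Section DistanceFormula.
Variables (G : sgraph) (D : G -> G -> nat).
Hypothesis D_refl : forall x, D x x = 0.
Hypothesis D_eq0 : forall x y, D x y = 0 -> x = y.
Hypothesis D_step : forall x y z, adj y z -> D x z <= (D x y).+1.
Hypothesis D_desc :
  forall x y, 0 < D x y -> exists2 z, adj z y & (D x z).+1 = D x y.

(** A function which behaves like a distance along edges, and from which one
    can always step back towards the source, is realised by paths. *)
Lemma geodesic x y :
  exists p, [/\ path (@adj G) x p, last x p = y & size p = D x y].
Proof.
have [m] := ubnP (D x y); elim: m y => // m IH y lt_m.
have [/D_eq0 <-|D_gt0] := posnP (D x y); first by exists [::]; rewrite D_refl.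
have [z zy Dz] := D_desc D_gt0.
have [|p [xp lp sp]] := IH z; first by rewrite -ltnS Dz.
by exists (rcons p y); rewrite rcons_path last_rcons size_rcons xp lp sp.
Qed.

Lemma geodesic_le x p : path (@adj G) x p -> D x (last x p) <= size p.
Proof.
elim/last_ind: p => [|p z IH]; first by rewrite /= D_refl.
rewrite rcons_path last_rcons size_rcons => /andP[/IH le_p /D_step le_z].
by apply: leq_trans (le_z x) _.
Qed.

Lemma distE x y : D x y <= #|G| -> dist x y = D x y.
Proof.
move=> le_D; apply/eqP; rewrite eqn_leq; apply/andP; split.
  by have [p [xp lp <-]] := geodesic x y; apply: dist_le.
by apply: dist_ge => // p /geodesic_le + lp; rewrite lp.
Qed.

Lemma geodesic_connected : 0 < #|G| -> connected_graph G.
Proof.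
rewrite /connected_graph => ->; apply/forall_inP => x _; apply/forall_inP => y _.
have [p [xp lp _]] := geodesic x y; apply/connectP; exists p => //.
by rewrite (eq_path (e' := @adj G)) // => u v; rewrite /induced_adj /= !in_setT.
Qed.
End DistanceFormula.

(** * Nonseparable sets and separations *)

Section Separation.
Variable G : sgraph.

(** If S has no neighbour outside itself but v, then a set B without
    cut-vertices lies on one side of v: for v in B, removing v would otherwise
    disconnect B, and for v outside B the set B itself would be disconnected. *)
Lemma nonseparable_sub_side (B S : {set G}) (v : G) :
    nonseparable B ->
    (forall x y, x \in S -> adj x y -> (y \in S) || (y == v)) ->
  forall x y, x \in B -> y \in B -> x \in S -> x != v -> y != v -> y \in S.
Proof.
case/and3P => _ conB /forallP cutB sepS x y xB yB xS xv yv.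
have conBv : induced_connected (B :\ v).
  have := cutB v; rewrite /cut_vertex; case vB: (v \in B) => /=.
    by rewrite negbK.
  move=> _; rewrite (_ : B :\ v = B) //; apply/setDidPl.
  by rewrite disjoint_sym disjoints1 vB.
have /connectP[p xp ->] : connect (induced_adj (B :\ v)) x y.
  by apply: (forall_inP (forall_inP conBv x _)); rewrite in_setD1 ?xv ?yv.
elim: p x xS xp {xB xv} => //= z p IH x xS /andP[/and3P[_ zB xz]].
apply: IH; have := sepS _ _ xS xz.
by move: zB; rewrite in_setD1 => /andP[/negPf -> _]; rewrite orbF.
Qed.

Lemma complete_nonseparable (B : {set G}) :
  B != set0 -> complete_set B -> nonseparable B.
Proof.
move=> B0 comB; rewrite /nonseparable B0.
have con (C : {set G}) : C \subset B -> induced_connected C.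
  move=> /subsetP CB; apply/forall_inP => x xC; apply/forall_inP => y yC.
  have [->|xy] := eqVneq x y; first exact: connect0.
  apply: connect1; rewrite /induced_adj /= xC yC.
  by have /forall_inP/(_ y (CB y yC))/implyP := forall_inP comB x (CB x xC); apply.
rewrite con //=; apply/forallP => v; rewrite /cut_vertex negb_and negbK con ?orbT //.
exact: subD1set.
Qed.
End Separation.

(** * Bounds on the radio number from levels *)

Section RadioBounds.
Variables (G : sgraph) (l : G -> nat).
Hypothesis dist_levels : forall u v : G, u != v -> dist u v <= l u + l v + 1.

(** Along the vertices sorted by label, each step from u to v costs at least
    diam - l u - l v; in the sum each level is counted twice at most. *)
Lemma radio_span_ge (f : G -> nat) : radio_labeling f ->
  #|G|.-1 * diam G <= label_span f + 2 * \sum_v l v.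
Proof.
move=> radf.
have chain x s : path (relpre f leq) x s -> uniq (x :: s) ->
    f x + size s * diam G + l (last x s) <= f (last x s) + l x + 2 * \sum_(y <- s) l y.
  elim: s x => [|y s IH] x /=; first by rewrite big_nil; lia.
  case/andP=> le_xy /IH {}IH /andP[xs us]; move: (IH us) => {}IH.
  have xy : x != y by apply: contraNneq xs => ->; rewrite inE eqxx.
  have := radf _ _ xy; have := dist_levels xy; rewrite big_cons; lia.
have perm_s := permEl (perm_sort (relpre f leq) (enum G)).
have := perm_size perm_s; rewrite -cardE.
have sort_s : sorted (relpre f leq) (sort (relpre f leq) (enum G)).
  by apply: sort_sorted => u v; apply: leq_total.
have uniq_s : uniq (sort (relpre f leq) (enum G)) by rewrite sort_uniq enum_uniq.
have sum_s : \sum_v l v = \sum_(v <- sort (relpre f leq) (enum G)) l v.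
  by rewrite (perm_big _ perm_s) big_enum.
rewrite sum_s; case: (sort _ _) sort_s uniq_s => [|x s] /=; first by move=> _ _ <-.
move=> xs us <-; have := chain x s xs us; rewrite big_cons /=.
have : f (last x s) - f x <= label_span f.
  apply: leq_trans (leq_bigmax (F := fun u => \max_v _) (last x s)).
  apply: leq_trans (leq_bigmax (F := fun v => `|f _ - f v|%N) x); lia.
lia.
Qed.

(* An ordering of the vertices: [pos v] is the place of v and [lev m] the level
   found at place m. Outside the places in use [lev] only has to stay small. *)
Variables (pos : G -> nat) (lev : nat -> nat).
Hypothesis pos_inj : injective pos.
Hypothesis pos_lt : forall v, pos v < #|G|.
Hypothesis lev_pos : forall v, lev (pos v) = l v.
Hypothesis lev_lt : forall t, 2 * lev t < diam G.
Hypothesis lev_first : lev 0 = 0.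
Hypothesis lev_last : lev #|G|.-1 = 0.
Hypothesis pos_spread : forall u v : G, u != v ->
  dist u v = l u + l v + 1 \/ diam G <= `|pos u - pos v|.

(* The label given to the vertex at place t. *)
Let F t := \sum_(s < t) (diam G - (lev s + lev s.+1)).

Let FS t : F t.+1 + (lev t + lev t.+1) = F t + diam G.
Proof. rewrite /F big_ord_recr /=; have := lev_lt t; have := lev_lt t.+1; lia. Qed.

Let F_add t e : F t + e <= F (t + e).
Proof.
elim: e => [|e IH]; first by rewrite !addn0.
rewrite !addnS; have := FS (t + e); have := lev_lt (t + e).
have := lev_lt (t + e).+1; lia.
Qed.

(* [FS] gives equality for one step; afterwards F m + lev m does not decrease
   with m, since F m.+1 + lev m.+1 = F m + diam G - lev m. *)
Let F_gap t e : F t + diam G <= F (t + e.+1) + (lev t + lev (t + e.+1)).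
Proof.
elim: e => [|e IH]; first by rewrite addn1 FS.
rewrite addnS; have := FS (t + e.+1); have := lev_lt (t + e.+1).
have := lev_lt (t + e.+2); lia.
Qed.

Let F_total t : F t + 2 * \sum_(s < t.+1) lev s = t * diam G + lev 0 + lev t.
Proof.
elim: t => [|t IH]; first by rewrite /F big_ord0 big_ord1 /=; lia.
rewrite [\sum_(s < t.+2) _]big_ord_recr /= (mulSn t); have := FS t; move: IH.
set S := \sum_(s < _) _; lia.
Qed.

Let sum_lev : \sum_(s < #|G|) lev s = \sum_v l v.
Proof.
pose o v := Ordinal (pos_lt v).
have o_inj : injective o by move=> u v /(congr1 val) /pos_inj.
rewrite (reindex o) /=; first by apply: eq_bigr => v _; apply: lev_pos.
by apply: onW_bij; apply: inj_card_bij => //; rewrite card_ord.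
Qed.

(** The ordering makes the bound of [radio_span_ge] tight: labels grow by the
    least amount permitted between consecutive vertices, and no level is lost
    at the two ends because both have level 0. *)
Lemma radio_number_spread :
  radio_number G = #|G|.-1 * diam G - 2 * \sum_v l v.
Proof.
rewrite /radio_number; case: ex_minnP => m /asboolP[f radf <-] min_f.
apply/eqP; rewrite eqn_leq leq_subLR addnC radio_span_ge // andbT.
have radF : radio_labeling (F \o pos).
  have close a b : a < b -> F a + diam G <= F b + lev a + lev b.
    move=> lt_ab; have := F_gap a (b - a.+1).
    have -> : a + (b - a.+1).+1 = b by lia.
    by rewrite addnA.
  have far a b : a + diam G <= b -> F a + diam G <= F b.
    by move=> le_ab; have := F_add a (b - a); rewrite subnKC; lia.
  move=> u v uv /=; have d_gt0 := dist_gt0 uv.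
  have [lt|lt|/pos_inj eq] := ltngtP (pos u) (pos v); last by rewrite eq eqxx in uv.
    have := close _ _ lt; rewrite !lev_pos.
    by case: (pos_spread uv); last (have := far (pos u) (pos v)); lia.
  have := close _ _ lt; rewrite !lev_pos.
  by case: (pos_spread uv); last (have := far (pos v) (pos u)); lia.
have /min_f/leq_trans : `[< is_radio_span G (label_span (F \o pos)) >].
  by apply/asboolP; exists (F \o pos).
apply.
have Fle v : F (pos v) <= F #|G|.-1.
  have -> : #|G|.-1 = pos v + (#|G|.-1 - pos v) by have := pos_lt v; lia.
  by apply: leq_trans (F_add _ _); apply: leq_addr.
apply: (@leq_trans (F #|G|.-1)).
  apply/bigmax_leqP => u _; apply/bigmax_leqP => v _ /=.
  move: (Fle u) (Fle v); move: (F #|G|.-1) (F (pos u)) (F (pos v)) => c a b; lia.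
have := F_total #|G|.-1; rewrite lev_first lev_last.
have [G0|Gpos] := posnP #|G|; first by rewrite G0 /F big_ord0.
rewrite prednK // sum_lev; lia.
Qed.
End RadioBounds.

(** * The line graph of the banana tree: vertices and adjacency *)

Lemma pairs_meet (V : finType) (a b c d : V) :
  ([set a; b] :&: [set c; d] != set0) = [|| a == c, a == d, b == c | b == d].
Proof.
apply/set0Pn/idP => [[z]|].
  by rewrite !inE => /andP[/orP[] /eqP <- /orP[] /eqP <-]; rewrite eqxx ?orbT.
by case/or4P=> /eqP e; [exists a|exists a|exists b|exists b];
  rewrite !inE -e !eqxx ?orbT.
Qed.

Section BananaLineGraph.
Variables n k : nat.
Let T := banana n k.
Let G := line_graph T.

(** The location of a vertex within its branch: [None] is the edge at the root,
    [Some None] the edge below it, [Some (Some j)] the j-th pendant edge. *)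
Definition slot : finType := option (option 'I_(k - 2)).
Definition position : finType := ('I_n * slot)%type.
Implicit Types (s t : slot) (c : position).

Definition slot_level s : nat :=
  match s with None => 0 | Some None => 1 | Some (Some _) => 2 end.

Definition lower_end c : T :=
  match c with
  | (i, None) => Mid k i
  | (i, Some None) => Hub k i
  | (i, Some (Some j)) => Leaf i j
  end.

Definition upper_end c : T :=
  match c with
  | (i, None) => Root n k
  | (i, Some None) => Mid k i
  | (i, Some (Some j)) => Hub k i
  end.

Lemma parent_lower_end c : banana_parent (lower_end c) = Some (upper_end c).
Proof. by case: c => i [[j|]|]. Qed.

Lemma lower_end_inj : injective lower_end.
Proof. by case=> i [[j|]|] [i' [[j'|]|]] //= [-> // ->]. Qed.

Lemma parent_ends (u v : T) : banana_parent u = Some v ->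
  exists2 c, u = lower_end c & v = upper_end c.
Proof.
case: u => [|i|i|i j] //= [<-].
- by exists (i, None).
- by exists (i, Some None).
- by exists (i, Some (Some j)).
Qed.

Lemma ends_in_edges c : [set lower_end c; upper_end c] \in edges T.
Proof.
apply/imsetP; exists (lower_end c, upper_end c) => //.
by rewrite inE; apply/banana_adjP; left; apply: parent_lower_end.
Qed.

Definition edge c : G :=
  exist (fun E : {set T} => E \in edges T) _ (ends_in_edges c).

Lemma edge_inj : injective edge.
Proof.
move=> c c' /(congr1 val) /= eqE.
have depth (a : position) := banana_parent_depth (parent_lower_end a).
have : lower_end c \in [set lower_end c'; upper_end c'] by rewrite -eqE set21.
have : lower_end c' \in [set lower_end c; upper_end c] by rewrite eqE set21.
rewrite !inE => /orP[/eqP/lower_end_inj //|/eqP e1] /orP[/eqP/lower_end_inj //|/eqP e2].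
by have := depth c; have := depth c'; rewrite e1 e2; lia.
Qed.

Lemma edge_surj (x : G) : exists c, edge c == x.
Proof.
have /imsetP[[u v]] := valP x.
rewrite inE /= => /banana_adjP[] /parent_ends[c -> ->] def_x;
  by exists c; apply/eqP/val_inj; apply: etrans (esym def_x); rewrite //= setUC.
Qed.

Definition place (x : G) : position := xchoose (edge_surj x).

Lemma placeK : cancel place edge.
Proof. by move=> x; apply/eqP; apply: (xchooseP (edge_surj x)). Qed.

Lemma edgeK : cancel edge place.
Proof. by move=> c; apply: edge_inj; rewrite placeK. Qed.

Lemma edge_bij : bijective edge.
Proof. by exists place; [apply: edgeK | apply: placeK]. Qed.

(** Inside a branch all pairs are adjacent except the edge at the root with
    the pendant edges; across branches only the edges at the root meet. *)
Lemma adj_edge i s j t : adj (edge (i, s)) (edge (j, t)) =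
  ((i, s) != (j, t)) &&
  (if i == j
   then (slot_level s <= (slot_level t).+1) && (slot_level t <= (slot_level s).+1)
   else (slot_level s == 0) && (slot_level t == 0)).
Proof.
rewrite /adj /= /line_adj /= (inj_eq edge_inj); congr (_ && _).
rewrite pairs_meet.
have enc (x y : T) : (x == y) = (banana_encode x == banana_encode y).
  by rewrite (inj_eq (can_inj (@banana_encodeK n k))).
have inlE (A B : eqType) (x y : A) : (inl x == inl y :> A + B) = (x == y) by [].
have inrE (A B : eqType) (x y : B) : (inr x == inr y :> A + B) = (x == y) by [].
have inlrE (A B : eqType) (x : A) (y : B) : (inl x == inr y) = false by [].
have inrlE (A B : eqType) (x : A) (y : B) : (inr y == inl x) = false by [].
by rewrite !enc; case: s t => [[a|]|] [[b|]|] /=;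
  rewrite ?inlE ?inrE ?inlrE ?inrlE ?xpair_eqE; case: eqP; rewrite ?orbT.
Qed.
End BananaLineGraph.

(** * Metric and block structure of the line graph *)

Section BananaLineMetric.
Variables n k : nat.
Hypotheses (hn : 5 <= n) (hk : 4 <= k).
Let T := banana n k.
Let G := line_graph T.
Implicit Types (i j : 'I_n) (s t : slot k) (c : position n k).

Lemma card_banana_line : #|G| = n * k.
Proof.
rewrite -(bij_eq_card (edge_bij n k)) card_prod card_ord !card_option card_ord.
by congr (_ * _); lia.
Qed.

(** The maximum with 1 accounts for distinct pendant edges of one branch, which
    have the same level but are at distance 1. *)
Definition slot_dist s t :=
  if s == t then 0
  else maxn 1 (slot_level s - slot_level t + (slot_level t - slot_level s)).

Definition place_dist c c' :=
  if c.1 == c'.1 then slot_dist c.2 c'.2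
  else slot_level c.2 + slot_level c'.2 + 1.

Lemma slot_level_le2 s : slot_level s <= 2.
Proof. by case: s => [[]|]. Qed.

Lemma slot_level_eq0 s : (slot_level s == 0) = (s == None).
Proof. by case: s => [[]|]. Qed.

Let D (x y : G) := place_dist (place x) (place y).

Let D_refl x : D x x = 0.
Proof. by rewrite /D /place_dist /slot_dist !eqxx. Qed.

Let D_eq0 x y : D x y = 0 -> x = y.
Proof.
have [[i s] /eqP <-] := edge_surj x; have [[j t] /eqP <-] := edge_surj y.
rewrite /D !edgeK /place_dist /slot_dist /=.
by case: eqP => [->|_]; last lia; case: eqP => [->|_]; last lia.
Qed.

Let D_step x y z : adj y z -> D x z <= (D x y).+1.
Proof.
have [[i s] /eqP <-] := edge_surj x.
have [[j t] /eqP <-] := edge_surj y; have [[j' t'] /eqP <-] := edge_surj z.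
rewrite /D !edgeK adj_edge /place_dist /slot_dist /= => /andP[_].
case: (j =P j') => [<-|jj'].
  case: (i =P j) => _; last by lia.
  by case: (s =P t) => [<-|_]; case: eqP => _; lia.
move=> /andP[/eqP t0 /eqP t'0]; rewrite t0 t'0.
case: (i =P j') => [->|_]; last first.
  by case: (i =P j) => _; [case: (s =P t) => [->|_]|]; lia.
by have := slot_level_le2 s; case: ifP => _; case: eqP => [/esym //|_]; lia.
Qed.

(* The last vertex of a geodesic before (j, t): in another branch, the vertex
   above it, or the root edge of the source branch if t is already a root edge;
   in the same branch, the source itself, or the middle vertex when the source
   is two levels away. *)
Let D_desc x y : 0 < D x y -> exists2 z, adj z y & (D x z).+1 = D x y.
Proof.
have [[i s] /eqP <-] := edge_surj x; have [[j t] /eqP <-] := edge_surj y.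
have desc c : adj (edge c) (edge (j, t)) ->
    (place_dist (i, s) c).+1 = place_dist (i, s) (j, t) ->
    exists2 z : G, adj z (edge (j, t))
      & (D (edge (i, s)) z).+1 = place_dist (i, s) (j, t).
  by exists (edge c); rewrite // /D !edgeK.
rewrite {1 3}/D !edgeK; have [eq_ij|neq_ij] := eqVneq i j.
  rewrite eq_ij in desc *; rewrite {1}/place_dist /slot_dist /= eqxx.
  have [//|neq_st _] := eqVneq s t.
  case near: ((slot_level s <= (slot_level t).+1) && (slot_level t <= (slot_level s).+1)).
    apply: (desc (j, s)); first by rewrite adj_edge xpair_eqE eqxx neq_st near.
    by rewrite /place_dist /slot_dist /= !eqxx (negPf neq_st); lia.
  apply: (desc (j, Some None)).
    rewrite adj_edge xpair_eqE eqxx /=.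
    by move: near; case: (s) (t) => [[a|]|] [[b|]|].
  rewrite /place_dist /slot_dist /= !eqxx; move: near.
  by case: (s) (t) => [[a|]|] [[b|]|].
move=> _; case: t desc => [[b|]|] desc.
- apply: (desc (j, Some None)); first by rewrite adj_edge xpair_eqE eqxx.
  by rewrite /place_dist /= (negPf neq_ij); lia.
- apply: (desc (j, None)); first by rewrite adj_edge xpair_eqE eqxx.
  by rewrite /place_dist /= (negPf neq_ij); lia.
- apply: (desc (i, None)); first by rewrite adj_edge xpair_eqE (negPf neq_ij).
  rewrite /place_dist /slot_dist /= eqxx (negPf neq_ij).
  by have := slot_level_eq0 s; case: (s =P None) => _ /eqP; lia.
Qed.

Lemma place_dist_le c c' : place_dist c c' <= 5.
Proof.
rewrite /place_dist /slot_dist.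
by have := slot_level_le2 c.2; have := slot_level_le2 c'.2; do 2?case: ifP; lia.
Qed.

Lemma dist_edge c c' : dist (edge c) (edge c') = place_dist c c'.
Proof.
rewrite (distE D_refl D_eq0 D_step D_desc) /D ?edgeK //.
by apply: leq_trans (place_dist_le _ _) _; rewrite card_banana_line; nia.
Qed.

Lemma banana_line_connected : connected_graph G.
Proof.
by apply: (geodesic_connected D_refl D_eq0 D_desc); rewrite card_banana_line; nia.
Qed.

Lemma diam_banana_line : diam G = 5.
Proof.
apply/eqP; rewrite eqn_leq; apply/andP; split.
  apply/bigmax_leqP => x _; apply/bigmax_leqP => y _.
  have [c /eqP <-] := edge_surj x; have [c' /eqP <-] := edge_surj y.
  by rewrite dist_edge place_dist_le.
have lt0 : 0 < n by lia. have lt1 : 1 < n by lia. have k2 : 0 < k - 2 by lia.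
pose tip i : G := edge (i, Some (Some (Ordinal k2))).
apply: leq_trans (leq_bigmax (F := fun u => \max_v _) (tip (Ordinal lt0))).
apply: leq_trans (leq_bigmax (F := fun v => dist _ v) (tip (Ordinal lt1))).
by rewrite dist_edge.
Qed.

Definition center i : G := edge (i, None).
Definition centers : {set G} := [set center i | i : 'I_n].

Lemma center_inj : injective center.
Proof. by move=> i j /edge_inj []. Qed.

Lemma card_centers : #|centers| = n.
Proof. by rewrite card_imset ?card_ord //; apply: center_inj. Qed.

Lemma mem_centers i s : (edge (i, s) \in centers) = (s == None).
Proof.
apply/imsetP/eqP => [[j _ /edge_inj [_ //]]|->]; last by exists i.
Qed.

Lemma centers_complete : complete_set centers.
Proof.
apply/forall_inP => _ /imsetP[i _ ->]; apply/forall_inP => _ /imsetP[j _ ->].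
by apply/implyP; rewrite (inj_eq center_inj) adj_edge xpair_eqE => /negPf->.
Qed.

(** Two non-adjacent vertices are separated by one of the cuts: the middle
    vertex of a branch cuts off its pendant edges, and the root edge of a branch
    cuts off everything below. *)
Lemma banana_line_nonseparable_complete (B : {set G}) :
  nonseparable B -> complete_set B.
Proof.
move=> nsB; pose shell i m : {set G} :=
  [set x | ((place x).1 == i) && (m < slot_level (place x).2)].
have sep_center i x y : x \in shell i 0 -> adj x y ->
    (y \in shell i 0) || (y == center i).
  have [[j t] /eqP <-] := edge_surj x; have [[j' t'] /eqP <-] := edge_surj y.
  rewrite !inE !edgeK adj_edge (inj_eq (@edge_inj n k)) !xpair_eqE /=.
  rewrite -slot_level_eq0 => /andP[/eqP -> t_gt0] /andP[_];
  by case: eqP => [<-|_]; rewrite ?eqxx /=; lia.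
have sep_hub i x y : x \in shell i 1 -> adj x y ->
    (y \in shell i 1) || (y == edge (i, Some None)).
  have [[j t] /eqP <-] := edge_surj x; have [[j' t'] /eqP <-] := edge_surj y.
  rewrite !inE !edgeK adj_edge (inj_eq (@edge_inj n k)) !xpair_eqE /=.
  case/andP=> /eqP -> t_gt1 /andP[_]; case: eqP => [<-|_]; last by lia.
  by move: t_gt1; case: (t) (t') => [[a|]|] [[b|]|] //=; rewrite ?eqxx ?orbT.
have one_branch i s j t : edge (i, s) \in B -> edge (j, t) \in B ->
    0 < slot_level s -> i = j.
  move=> xB yB s_gt0; apply/eqP/negPn/negP => /negPf neq_ij.
  have := nonseparable_sub_side nsB (sep_center i) xB yB.
  rewrite !(inj_eq (@edge_inj n k)) !inE !edgeK !xpair_eqE /= (eq_sym j) neq_ij.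
  by rewrite eqxx s_gt0 -slot_level_eq0 -lt0n s_gt0 => /(_ isT isT isT).
have hub_side i s t : edge (i, s) \in B -> edge (i, t) \in B ->
    1 < slot_level s -> 0 < slot_level t.
  move=> xB yB s_gt1; have := nonseparable_sub_side nsB (sep_hub i) xB yB.
  rewrite !(inj_eq (@edge_inj n k)) !inE !edgeK !xpair_eqE /= eqxx s_gt1 /=.
  by move: s_gt1; case: (s) (t) => [[a|]|] [[b|]|] //= _ /(_ isT isT isT).
apply/forall_inP => x xB; apply/forall_inP => y yB; apply/implyP => neq_xy.
have [[i s] /eqP def_x] := edge_surj x; have [[j t] /eqP def_y] := edge_surj y.
subst x y; rewrite adj_edge -(inj_eq (@edge_inj n k)) neq_xy /=.
have stB := one_branch _ _ _ _ xB yB; have tsB := one_branch _ _ _ _ yB xB.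
have [eq_ij|/eqP neq_ij] := eqVneq i j; last first.
  by apply/andP; split; apply/negPn/negP => l0; apply: neq_ij;
    [apply: stB | apply/esym/tsB]; rewrite lt0n.
rewrite -eq_ij in yB; have := hub_side _ _ _ xB yB; have := hub_side _ _ _ yB xB.
by case: (s) (t) => [[a|]|] [[b|]|] //= H1 H2; [have := H2 isT|have := H1 isT].
Qed.

(** A complete set containing all the root edges cannot contain a deeper vertex,
    which is adjacent to at most one of them. *)
Lemma block_with_centers (B : {set G}) : block B -> centers \subset B -> B = centers.
Proof.
move=> /maxsetP[nsB _] cB; apply/eqP; rewrite eqEsubset cB andbT.
have comB := banana_line_nonseparable_complete nsB.
apply/subsetP => x xB; have [[i s] /eqP def_x] := edge_surj x.
rewrite -def_x mem_centers -slot_level_eq0; apply: contraT => s_neq0.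
have [j neq_ij] : exists j, i != j.
  have : 0 < #|predC1 i| by rewrite cardC1 card_ord; lia.
  by case/card_gt0P => j; rewrite !inE eq_sym => neq_ij; exists j.
have jB : center j \in B by apply: (subsetP cB); apply: imset_f.
have := forall_inP (forall_inP comB x xB) _ jB; rewrite -def_x adj_edge.
by rewrite (inj_eq (@edge_inj n k)) xpair_eqE (negPf neq_ij) (negPf s_neq0).
Qed.

Lemma block_centers : block centers.
Proof.
have nsC : nonseparable centers.
  apply: complete_nonseparable centers_complete.
  by rewrite -card_gt0 card_centers; lia.
have [B blB cB] := maxset_exists nsC.
by rewrite -(block_with_centers blB cB).
Qed.

Lemma banana_line_block_graph : block_graph G.
Proof.
rewrite /block_graph banana_line_connected; apply/forallP => B; apply/implyP.
by move=> /maxsetP[nsB _]; apply: banana_line_nonseparable_complete.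
Qed.

Lemma sum_places (F : position n k -> nat) :
  \sum_(x : G) F (place x) = \sum_i \sum_s F (i, s).
Proof.
rewrite pair_big (reindex _ (onW_bij _ (edge_bij n k))) /=.
by apply: eq_bigr => -[i s] _; rewrite edgeK.
Qed.

Lemma sum_slot_level : \sum_(s : slot k) slot_level s = 2 * k - 3.
Proof.
have sum1 (a : slot k) : \sum_(s : slot k) (s == a : nat) = 1.
  by rewrite -big_mkcond /= big_pred1_eq.
have : \sum_(s : slot k) (slot_level s + 2 * (s == None) + (s == Some None)) = 2 * k.
  rewrite (eq_bigr (fun=> 2)) => [|[[]|] //].
  by rewrite sum_nat_const !card_option card_ord; lia.
by rewrite big_split /= big_split /= -big_distrr /= !sum1; lia.
Qed.

Lemma sum_other_branch i : \sum_(j < n) (j != i : nat) = n.-1.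
Proof. by rewrite -big_mkcond sum1_card cardC1 card_ord. Qed.

Lemma wt_center i : wt (center i) = n * (2 * k - 3) + n.-1 * k.
Proof.
rewrite /wt (eq_bigr (fun x => slot_level (place x).2 + ((place x).1 != i))); last first.
  move=> x _; rewrite -{1}[x]placeK dist_edge /place_dist /slot_dist /=.
  by case: (place x) => j [[b|]|] /=; case: eqP.
rewrite (sum_places (fun c => slot_level c.2 + (c.1 != i))) /=.
under eq_bigr => j _ do rewrite big_split sum_nat_const /= sum_slot_level.
rewrite big_split /= -big_distrr /= sum_other_branch sum_nat_const card_ord.
by rewrite !card_option card_ord; congr (_ + _); rewrite mulnC; congr (_ * _); lia.
Qed.

(** Compared with the root edge of its branch, a vertex of level l is l further
    from each of the (n - 1)k vertices of other branches and at most l closer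
    to each of the k vertices of its own. *)
Lemma wt_edge_gt i s : 0 < slot_level s -> wt (center i) < wt (edge (i, s)).
Proof.
move=> s_gt0.
have sumc m : \sum_(x : G) ((place x).1 != i) * m = n.-1 * (k * m).
  rewrite (sum_places (fun c => (c.1 != i) * m)) /=.
  under eq_bigr => j _ do rewrite sum_nat_const mulnCA.
  rewrite -big_distrl /= sum_other_branch !card_option card_ord.
  by do 2!congr (_ * _); lia.
have sum_const m : \sum_(x : G) m = n * (k * m).
  by rewrite sum_nat_const card_banana_line mulnA.
pose l := slot_level s.
(* Adding l to both sides keeps the comparison within the natural numbers:
   the difference l or -l becomes 2l or 0. *)
have le_sum : \sum_(x : G) (dist x (center i) + 2 * (((place x).1 != i) * l))
    <= \sum_(x : G) (dist x (edge (i, s)) + l).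
  apply: leq_sum => x _; rewrite -{1 3}[x]placeK !dist_edge /place_dist /slot_dist /=.
  case: (place x) => j t /=; move: s_gt0.
  by case: t s @l => [[b|]|] [[a|]|] //= _; case: eqP => //= _; case: ifP.
have le_wt : wt (center i) + 2 * (n.-1 * (k * l)) <= wt (edge (i, s)) + n * (k * l).
  by move: le_sum; rewrite big_split /= -big_distrr /= sumc big_split /= sum_const.
have kl_gt0 : 0 < k * l by rewrite muln_gt0 s_gt0 andbT; lia.
move: (wt _) (wt _) (k * l) le_wt kl_gt0 => a b m; nia.
Qed.

Lemma weight_centers_banana_line : weight_centers G = centers.
Proof.
apply/setP => x; have [[i s] /eqP <-] := edge_surj x.
rewrite mem_centers -slot_level_eq0 inE; apply/forallP/idP => [/(_ (center i))|s0 y].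
  by rewrite leqNgt; apply: contraNT; rewrite -lt0n; apply: wt_edge_gt.
have -> : s = None by apply/eqP; rewrite -slot_level_eq0.
have [[j t] /eqP <-] := edge_surj y; rewrite -/(center i) wt_center -(wt_center j).
have [t0|/wt_edge_gt-/(_ j)/ltnW//] := posnP (slot_level t).
by have -> : t = None by apply/eqP; rewrite -slot_level_eq0 t0.
Qed.

Lemma weight_centers_neq1 : (#|weight_centers G| == 1) = false.
Proof. by rewrite weight_centers_banana_line card_centers; lia. Qed.

Lemma central_vertices_banana_line : central_vertices G = centers.
Proof.
rewrite /central_vertices weight_centers_neq1 /central_block weight_centers_banana_line.
case: pickP => [B /andP[blB cB]|/(_ centers)] /=; first exact: block_with_centers.
by rewrite block_centers subxx.
Qed.

Lemma level_edge i s : level (edge (i, s)) = slot_level s.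
Proof.
rewrite /level central_vertices_banana_line; apply/eqP; rewrite eqn_leq.
rewrite -minEnat -!leEnat; apply/andP; split.
  apply: (Order.TotalTheory.bigmin_inf (center i)); rewrite ?imset_f // leEnat dist_edge.
  by rewrite /place_dist /slot_dist /= eqxx; case: (s) => [[b|]|].
apply: Order.POrderTheory.le_bigmin => [|_ /imsetP[j _ ->]]; rewrite leEnat.
  by rewrite card_banana_line; have := slot_level_le2 s; nia.
by rewrite dist_edge /place_dist /slot_dist /=; case: (s) => [[b|]|]; case: eqP.
Qed.

Lemma level_place (x : G) : level x = slot_level (place x).2.
Proof. by rewrite -{1}[x]placeK; case: (place x) => i s; rewrite level_edge. Qed.

Lemma total_level_banana_line : total_level G = n * (2 * k - 3).
Proof.
rewrite /total_level (eq_bigr _ (fun x _ => level_place x)).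
rewrite (sum_places (fun c => slot_level c.2)) /=.
under eq_bigr => j _ do rewrite sum_slot_level.
by rewrite sum_nat_const card_ord.
Qed.

Lemma LB_banana_line : LB G = Posz (n * (k + 6) - 5).
Proof.
rewrite /LB card_banana_line diam_banana_line total_level_banana_line.
rewrite /epsilon weight_centers_neq1 /=; nia.
Qed.

(** * An ordering attaining the lower bound *)

Definition rank s : nat :=
  match s with None => 0 | Some None => 1 | Some (Some j) => j.+2 end.

(** The last branch is traversed in reverse, so that its root edge comes in the
    last round, hence at the very last place. *)
Definition round i s := if i == n.-1 :> nat then k.-1 - rank s else rank s.

Definition visit (x : G) := round (place x).1 (place x).2 * n + (place x).1.

Definition visit_level m :=
  minn 2 (if m %% n == n.-1 then k.-1 - m %/ n else m %/ n).

Lemma rank_lt s : rank s < k.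
Proof. by case: s => [[j|]|] /=; [have := ltn_ord j|..]; lia. Qed.

Lemma rank_inj : injective rank.
Proof. by move=> [[a|]|] [[b|]|] //= [/ord_inj ->]. Qed.

Lemma slot_level_rank s : slot_level s = minn 2 (rank s).
Proof. by case: s => [[j|]|] //=; lia. Qed.

Lemma round_lt i s : round i s < k.
Proof. by have := rank_lt s; rewrite /round; case: ifP; lia. Qed.

Lemma visit_mod x : visit x %% n = (place x).1.
Proof. by rewrite /visit modnMDl modn_small. Qed.

Lemma visit_div x : visit x %/ n = round (place x).1 (place x).2.
Proof. by rewrite /visit divnMDl ?divn_small ?addn0 //; lia. Qed.

Lemma visit_inj : injective visit.
Proof.
move=> x y eq_v; apply: (can_inj (@placeK n k)).
have := visit_div x; rewrite eq_v visit_div.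
have := visit_mod x; rewrite eq_v visit_mod.
case: (place x) (place y) => [i s] [j t] /= /ord_inj -> eq_r.
congr (_, _); apply: rank_inj; move: eq_r; rewrite /round.
by have := rank_lt s; have := rank_lt t; case: ifP; lia.
Qed.

Lemma visit_lt x : visit x < #|G|.
Proof.
rewrite card_banana_line /visit; have := round_lt (place x).1 (place x).2.
by have := ltn_ord (place x).1; nia.
Qed.

Lemma visit_levelE x : visit_level (visit x) = level x.
Proof.
rewrite /visit_level visit_mod visit_div level_place slot_level_rank /round.
by have := rank_lt (place x).2; do 2!case: ifP; lia.
Qed.

(** Vertices of one branch are a multiple of n apart in the ordering, hence at
    least 5 = diam places apart. *)
Lemma radio_number_banana_line : radio_number G = n * (k + 6) - 5.
Proof.
have lev0 : visit_level 0 = 0.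
  by rewrite /visit_level mod0n div0n; case: ifP; lia.
have levN : visit_level #|G|.-1 = 0.
  rewrite card_banana_line /visit_level.
  have -> : (n * k).-1 = k.-1 * n + n.-1 by nia.
  by rewrite modnMDl modn_small ?divnMDl ?divn_small ?eqxx; lia.
have dist_lev (x y : G) : x != y -> dist x y <= level x + level y + 1 /\
    ((place x).1 != (place y).1 -> dist x y = level x + level y + 1).
  move=> neq_xy; rewrite !level_place -{1 4}[x]placeK -{1 4}[y]placeK dist_edge.
  rewrite /place_dist /slot_dist; case: ifP => _; split=> //; case: ifP; lia.
have lev_lt m : 2 * visit_level m < diam G.
  by rewrite diam_banana_line /visit_level; lia.
rewrite (radio_number_spread (fun x y ne => (dist_lev x y ne).1)
  visit_inj visit_lt visit_levelE lev_lt lev0 levN).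
  rewrite diam_banana_line card_banana_line -/(total_level G) total_level_banana_line.
  nia.
move=> x y neq_xy; have [eq_b|neq_b] := eqVneq (place x).1 (place y).1; last first.
  by left; apply: (dist_lev x y neq_xy).2.
right; rewrite diam_banana_line.
have far u v a b m : u != v -> u = a * n + m -> v = b * n + m -> 5 <= `|u - v|.
  move=> neq_uv def_u def_v.
  have mono p q : p < q -> p * n + n <= q * n.
    by move=> lt_pq; rewrite addnC -mulSn leq_mul2r lt_pq orbT.
  have [/mono ?|/mono ?|eq_ab] := ltngtP a b; [lia|lia|].
  by rewrite def_u def_v eq_ab eqxx in neq_uv.
have neq_v : visit x != visit y by rewrite (inj_eq visit_inj).
exact: (far _ _ _ _ _ neq_v erefl (congr1 (fun i => _ + val i) (esym eq_b))).
Qed.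
End BananaLineMetric.

Theorem corollary5p7 (n k : nat) (hn : (5 <= n)%N) (hk : (4 <= k)%N) :
  lower_bound_block_graph (line_graph (banana n k)) /\
  radio_number (line_graph (banana n k)) = (n * (k + 6) - 5)%N.
Proof.
have rnE := radio_number_banana_line hn hk; split=> //; split.
  exact: banana_line_block_graph.
by rewrite rnE LB_banana_line.
Qed.
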